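(* Let $d\ge 1$, let $P=([d],\preceq)$ be a partially ordered set on $[d]=\{1,\dots,d\}$ and let $s\colon[d]\to\mathbb{N}$ (positive integers). Let $\ell\ge 0$ and let $w\colon\mathbb{R}^d\to\mathbb{R}$ be given by $w(x)=w_1(x)\cdots w_\ell(x)$ (the empty product being $1$), where for each $i\in[\ell]$ the function $w_i$ is of one of the following forms: (i) $w_i(x)=\binom{x(k)+a}{b}$ for some $k\in[d]$ and integers $0\le a\le b$; (ii) $w_i(x)=\binom{\lfloor x(k)/s(k)\rfloor+a}{b}$ for some $k\in[d]$ and integers $0<a\le b$; (iii) $w_i(x)=\binom{\lceil x(k)/s(k)\rceil+a}{b}$ for some $k\in[d]$ and integers $0\le a<b$. (Here $k,a,b$ and the form may depend on $i$.) Then there exist a finite poset $P^\ast$ on $[d^\ast]$ for some integer $d^\ast$, and a map $s^\ast\colon[d^\ast]\to\mathbb{N}$, such that $$\mathrm{E}_{\mathcal{O}(P,s)}(w;n)=\mathrm{E}_{\mathcal{O}(P^\ast,s^\ast)}(n)\qquad\text{for all integers } n\ge 0 .$$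
   Context: Here $x(k)$ denotes the $k$-th coordinate of $x$, and $\binom{y}{b}=y(y-1)\cdots(y-b+1)/b!$ for real $y$ and integer $b\ge0$. Let $P=([d],\preceq)$ be a poset on $[d]$ and $s\colon[d]\to\mathbb{N}$ a map to the positive integers. A map $f\colon[d]\to\mathbb{R}$ (identified with a vector in $\mathbb{R}^d$) is called a $(P,s)$-partition if $f(i)/s(i)\le f(j)/s(j)$ whenever $i\prec j$, and $f(i)/s(i)<f(j)/s(j)$ whenever $i\prec j$ and $i>j$ as integers. The $s$-lecture hall order polytope $\mathcal{O}(P,s)\subset\mathbb{R}^d$ is the (in general half-open) polytope of all $(P,s)$-partitions $f\in\mathbb{R}^d$ with $0\le f(i)/s(i)\le 1$ for all $i\in[d]$. For an integer $n\ge0$, its $n$-th dilate $n\mathcal{O}(P,s)$ is the set of all $(P,s)$-partitions $f\in\mathbb{R}^d$ with $0\le f(i)/s(i)\le n$ for all $i$. For a function $w\colon\mathbb{R}^d\to\mathbb{R}$ the weighted Ehrhart function is $\mathrm{E}_{\mathcal{O}(P,s)}(w;n)=\sum_{x\in n\mathcal{O}(P,s)\cap\mathbb{Z}^d}w(x)$, and the Ehrhart function is $\mathrm{E}_{\mathcal{O}(P,s)}(n)=|n\mathcal{O}(P,s)\cap\mathbb{Z}^d|$, for integers $n\ge0$; the latter is given by a polynomial in $n$, the Ehrhart polynomial. The same definitions apply to $(P^\ast,s^\ast)$ with $d^\ast$ in place of $d$. *)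

(* Defs.v *)
From HB Require Import structures.
From mathcomp Require Import all_boot all_order all_algebra finmap.
From mathcomp Require Import all_classical all_reals.

Set Implicit Arguments.
Unset Strict Implicit.
Unset Printing Implicit Defensive.

Import Order.TTheory GRing.Theory Num.Theory.

Local Open Scope classical_set_scope.
Local Open Scope ring_scope.

(* Throughout, [d] = {1, ..., d} is 'I_d = {0, ..., d-1}; only the order of
   the labels matters.  R^d is {ffun 'I_d -> R}. *)

Definition partial_order (T : Type) (le : rel T) : Prop :=
  [/\ reflexive le, antisymmetric le & transitive le].

Definition strict (T : eqType) (le : rel T) : rel T :=
  fun i j => (i != j) && le i j.

Definition PS_partition (R : realType) (d : nat) (P : rel 'I_d)
    (s : 'I_d -> nat) (f : {ffun 'I_d -> R}) : Prop :=
  (forall i j : 'I_d, strict P i j -> f i / (s i)%:R <= f j / (s j)%:R) /\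
  (forall i j : 'I_d, strict P i j -> (j < i)%N ->
     f i / (s i)%:R < f j / (s j)%:R).

(* The polytope O(P,s) itself is the case n = 1.  The strict inequalities are
   kept for n = 0, so the 0-th dilate is empty if one of them occurs. *)
Definition lecture_hall_dilate (R : realType) (d : nat) (P : rel 'I_d)
    (s : 'I_d -> nat) (n : nat) : set {ffun 'I_d -> R} :=
  [set f | PS_partition P s f /\
           forall i : 'I_d, 0 <= f i / (s i)%:R <= n%:R].
Arguments lecture_hall_dilate R {d} P s n _.

Definition integer_points (R : realType) (d : nat) : set {ffun 'I_d -> R} :=
  [set f | forall i : 'I_d, f i \is a Num.int].
Arguments integer_points : clear implicits.

Definition lattice_points (R : realType) (d : nat) (P : rel 'I_d)
    (s : 'I_d -> nat) (n : nat) : set {ffun 'I_d -> R} :=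
  lecture_hall_dilate R P s n `&` integer_points R d.
Arguments lattice_points R {d} P s n _.

Definition weighted_ehrhart (R : realType) (d : nat) (P : rel 'I_d)
    (s : 'I_d -> nat) (w : {ffun 'I_d -> R} -> R) (n : nat) : R :=
  \sum_(x \in lattice_points R P s n) w x.

Definition ehrhart (R : realType) (d : nat) (P : rel 'I_d)
    (s : 'I_d -> nat) (n : nat) : nat :=
  #|` fset_set (lattice_points R P s n)|.
Arguments ehrhart R {d} P s n.

(* The finitely supported sum and [fset_set] above default to 0 and the empty
   set on infinite sets; this lemma shows that the default is never used. *)
Lemma finite_lattice_points (R : realType) (d : nat) (P : rel 'I_d)
    (s : 'I_d -> nat) (n : nat) :
  (forall i, (0 < s i)%N) -> finite_set (lattice_points R P s n).
Proof.
move=> s_gt0; pose N := \max_(i < d) (n * s i)%N.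
pose g (h : {ffun 'I_d -> 'I_N.+1}) : {ffun 'I_d -> R} :=
  [ffun i => (h i : nat)%:R].
apply: (@sub_finite_set _ _ (g @` setT)); last first.
  exact/finite_image/finite_finset.
move=> f [[_ fb] fint].
have fE i : exists k : 'I_N.+1, f i = (k : nat)%:R.
  have /andP[f0 fn] := fb i; have si0 : 0 < (s i)%:R :> R by rewrite ltr0n.
  have fi0 : 0 <= f i by move: f0; rewrite pmulr_lge0// invr_gt0.
  have /natrP[m fm] : f i \is a Num.nat by rewrite natrEint fint.
  have mN : (m < N.+1)%N.
    rewrite ltnS; apply: leq_trans (leq_bigmax i).
    by move: fn; rewrite ler_pdivrMr// fm -natrM ler_nat.
  by exists (Ordinal mN).
exists [ffun i => sval (cid (fE i))] => //.
apply/ffunP => i; rewrite !ffunE.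
by case: (cid (fE i)).
Qed.

Definition gbinom (R : realType) (y : R) (b : nat) : R :=
  (\prod_(i < b) (y - i%:R)) / (b`!)%:R.

Definition weight_coord (R : realType) (d : nat)
    (v : {ffun 'I_d -> R} -> R) : Prop :=
  exists (k : 'I_d) (a b : nat), (a <= b)%N /\
    forall x, v x = gbinom (x k + a%:R) b.

Definition weight_floor (R : realType) (d : nat) (s : 'I_d -> nat)
    (v : {ffun 'I_d -> R} -> R) : Prop :=
  exists (k : 'I_d) (a b : nat), (0 < a <= b)%N /\
    forall x, v x = gbinom ((Num.floor (x k / (s k)%:R))%:~R + a%:R) b.

Definition weight_ceil (R : realType) (d : nat) (s : 'I_d -> nat)
    (v : {ffun 'I_d -> R} -> R) : Prop :=
  exists (k : 'I_d) (a b : nat), (a < b)%N /\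
    forall x, v x = gbinom ((Num.ceil (x k / (s k)%:R))%:~R + a%:R) b.

(* Main.v *)
Require Import Defs.
From HB Require Import structures.
From mathcomp Require Import all_boot all_order all_algebra finmap.
From mathcomp Require Import all_classical all_reals.

Import Order.TTheory GRing.Theory Num.Theory.

Local Open Scope classical_set_scope.
Local Open Scope ring_scope.

(** For an admissible weight of degree b + 1 > 0 at the coordinate k, the
  hockey-stick identity [sum_(0 <= y < M) C(y + a, b) = C(M + a, b + 1)]
  (valid since a <= b) writes it as a sum, over integers y >= 0 with
  y / t <= x(k) / s(k) or y / t < x(k) / s(k), of the weight C(y + a, b) of form
  (i); here t = s(k) for form (i) and t = 1 for forms (ii) and (iii).  Such a y
  is the value of a (P,s)-partition at one new element placed below k with scale
  t, labelled first for a weak inequality and last for a strict one.  Hence the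
  total degree drops by one per added element, until all weights are 1. *)

(** * Binomial coefficients *)

Lemma gbinom_nat (R : realType) (n b : nat) :
  gbinom (n%:R : R) b = ('C(n, b))%:R.
Proof.
have prodE m : \prod_(i < m) (n%:R - i%:R) = (n ^_ m)%:R :> R.
  elim: m => [|m IHm]; first by rewrite big_ord0 ffactn0.
  rewrite big_ord_recr /= IHm ffactnSr natrM.
  have [mn|nm] := leqP m n; first by rewrite natrB.
  by rewrite ffact_small// !mul0r.
rewrite /gbinom prodE -bin_ffact natrM mulfK//.
by rewrite pnatr_eq0 -lt0n fact_gt0.
Qed.

(** Induction on [M] by Pascal's rule; [a <= b] serves the base case, where 'C(a, b.+1) must
    vanish. *)
Lemma hockey_stick (M a b : nat) : (a <= b)%N ->
  (\sum_(0 <= y < M) 'C(y + a, b) = 'C(M + a, b.+1))%N.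
Proof.
move=> ab; elim: M => [|M IHM]; first by rewrite big_nil bin_small.
by rewrite big_nat_recr//= IHM addSn binS.
Qed.

(** * Adjoining one element to a labelled poset *)

Definition extend {A : Type} {d : nat} (h : 'I_d.+1) (u : 'I_d -> A) (y : A)
  : 'I_d.+1 -> A := fun i => oapp u y (unlift h i).

Lemma extend_new (A : Type) (d : nat) (h : 'I_d.+1) (u : 'I_d -> A) (y : A) :
  extend h u y h = y.
Proof. by rewrite /extend unlift_none. Qed.

Lemma extend_old (A : Type) (d : nat) (h : 'I_d.+1) (u : 'I_d -> A) (y : A) i :
  extend h u y (lift h i) = u i.
Proof. by rewrite /extend liftK. Qed.

(** The order generated by [P] and the single new relation h < k; [h] is minimal in it. *)
Definition extend_rel {d : nat} (h : 'I_d.+1) (P : rel 'I_d) (k : 'I_d)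
  : rel 'I_d.+1 := fun i j =>
  match unlift h i, unlift h j with
  | Some i', Some j' => P i' j'
  | None, Some j' => P k j'
  | Some _, None => false
  | None, None => true
  end.

Lemma extend_rel_order (d : nat) (h : 'I_d.+1) (P : rel 'I_d) (k : 'I_d) :
  partial_order P -> partial_order (extend_rel h P k).
Proof.
case=> Prefl Panti Ptrans; rewrite /extend_rel; split.
- by move=> i; case: unliftP.
- move=> i j; case: (unliftP h i) => [i'|] ->; case: (unliftP h j) => [j'|] -> //;
    rewrite ?andbF//.
  by move/Panti ->.
- move=> j i m; case: (unlift h j) => [j'|]; case: (unlift h i) => [i'|];
    by case: (unlift h m) => [m'|] //; apply: Ptrans.
Qed.

(** An inequality of a (P,s)-partition is strict when the lower element has the larger label. The
    last label thus makes all inequalities above the new element strict, the first label makes them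
    all weak. *)
Definition extreme_label (strictly : bool) (d : nat) : 'I_d.+1 :=
  if strictly then ord_max else ord0.

Lemma lift_lt_extreme (strictly : bool) (d : nat) (j : 'I_d) :
  (lift (extreme_label strictly d) j < extreme_label strictly d)%N = strictly.
Proof. by case: strictly; rewrite /extreme_label ?lift_max ?ltn_ord. Qed.

Lemma ltn_lift (d : nat) (h : 'I_d.+1) (i j : 'I_d) :
  (lift h i < lift h j)%N = (i < j)%N.
Proof. by rewrite !ltnNge leq_bump2. Qed.

(** Only the inequality between the new element and [k] is new. Those with elements above [k], and
    the upper bound [n], follow from it by transitivity through [k]. *)
Lemma lattice_points_extend (R : realType) (d : nat) (P : rel 'I_d)
    (s : 'I_d -> nat) (k : 'I_d) (t : nat) (strictly : bool) (n : nat)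
    (x : {ffun 'I_d -> R}) (y : R) :
  partial_order P ->
  let h := extreme_label strictly d in
  lattice_points R (extend_rel h P k) (extend h s t) n
    [ffun i => extend h x y i] <->
  [/\ lattice_points R P s n x, y \is a Num.int, 0 <= y / t%:R &
      y / t%:R < x k / (s k)%:R ?<= if ~~ strictly].
Proof.
move=> [Prefl _ _] h; rewrite /lattice_points /lecture_hall_dilate.
rewrite /integer_points /PS_partition /=; split.
- case=> -[[le1 lt1] bd] int; split.
  + split; first split; first split.
    * move=> i j Pij; have := le1 (lift h i) (lift h j).
      rewrite !ffunE !extend_old; apply.
      by rewrite /strict (inj_eq lift_inj) /extend_rel !liftK.
    * move=> i j Pij ji; have := lt1 (lift h i) (lift h j).
      rewrite !ffunE !extend_old; apply; last by rewrite ltn_lift.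
      by rewrite /strict (inj_eq lift_inj) /extend_rel !liftK.
    * by move=> i; have := bd (lift h i); rewrite !ffunE !extend_old.
    * by move=> i; have := int (lift h i); rewrite !ffunE !extend_old.
  + by have := int h; rewrite !ffunE !extend_new.
  + by have := bd h; rewrite !ffunE !extend_new => /andP[].
  + have hk : strict (extend_rel h P k) h (lift h k).
      by rewrite /strict neq_lift /extend_rel unlift_none liftK Prefl.
    move: (le1 _ _ hk) (lt1 _ _ hk); rewrite lift_lt_extreme.
    rewrite !ffunE !extend_new !extend_old.
    by case: strictly @h {le1 lt1 bd int hk} => h //= _; apply.
- case=> -[[[le1 lt1] bd] int] yint y0 yk.
  have ykle : y / t%:R <= x k / (s k)%:R by exact: lteifW yk.
  have kle j : P k j -> x k / (s k)%:R <= x j / (s j)%:R.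
    by move=> Pkj; have [->//|kj] := eqVneq k j; apply: le1; rewrite /strict kj.
  split; first split; first split.
  + move=> i j; rewrite /strict /extend_rel !ffunE.
    case: (unliftP h i) => [i'|] ->; case: (unliftP h j) => [j'|] ->;
      rewrite ?(inj_eq lift_inj) ?andbF ?eqxx// ?extend_old ?extend_new.
      exact: le1.
    by move=> /andP[_ /kle]; apply: le_trans.
  + move=> i j; rewrite /strict /extend_rel !ffunE.
    case: (unliftP h i) => [i'|] ->; case: (unliftP h j) => [j'|] ->;
      rewrite ?(inj_eq lift_inj) ?andbF ?eqxx// ?extend_old ?extend_new.
      by rewrite ltn_lift; apply: lt1.
    (* A label inversion at [h] means that [strictly] holds, so [yk] is strict and stays so after
       composing with the weak inequality [kj]. *)
    move=> /andP[_ /kle kj]; rewrite lift_lt_extreme => st.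
    by apply: lt_le_trans kj; move: yk; rewrite st.
  + move=> i; rewrite !ffunE; case: (unliftP h i) => [i'|] ->.
      by rewrite !extend_old.
    rewrite !extend_new y0 (le_trans ykle)//.
    by have /andP[] := bd k.
  + move=> i; rewrite !ffunE; case: (unliftP h i) => [i'|] ->.
      by rewrite !extend_old.
    by rewrite extend_new.
Qed.

(** * Lattice-point sums as sums over a finite type *)

Definition natpt (R : realType) {d N : nat} (u : {ffun 'I_d -> 'I_N.+1})
  : {ffun 'I_d -> R} := [ffun i => (u i : nat)%:R].

Lemma natpt_inj (R : realType) (d N : nat) : injective (@natpt R d N).
Proof.
move=> u v /ffunP uv; apply/ffunP => i; apply/val_inj/eqP.
by have := uv i; rewrite !ffunE => /eqP; rewrite eqr_nat.
Qed.

Lemma lattice_point_nat (R : realType) (d : nat) (P : rel 'I_d)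
    (s : 'I_d -> nat) (n : nat) (x : {ffun 'I_d -> R}) (i : 'I_d) :
  (0 < s i)%N -> lattice_points R P s n x ->
  exists2 m : nat, x i = m%:R & (m <= n * s i)%N.
Proof.
move=> si [[_ bd] int]; have si0 : 0 < (s i)%:R :> R by rewrite ltr0n.
have /andP[xi0 xin] := bd i; rewrite pmulr_lge0 ?invr_gt0// in xi0.
have /natrP[m xm] : x i \is a Num.nat by rewrite natrEint int.
by exists m => //; rewrite ler_pdivrMr// xm -natrM ler_nat in xin.
Qed.

(** Lattice points have natural coordinates at most n * s i. The bound [N] is left free so that a
    poset and its extension can be summed over the same box. *)
Lemma weighted_ehrhart_natpt (R : realType) (d : nat) (P : rel 'I_d)
    (s : 'I_d -> nat) (w : {ffun 'I_d -> R} -> R) (n N : nat) :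
  (forall i, 0 < s i)%N -> (forall i, n * s i <= N)%N ->
  weighted_ehrhart P s w n =
  \sum_(u : {ffun 'I_d -> 'I_N.+1} | `[< lattice_points R P s n (natpt R u) >])
     w (natpt R u).
Proof.
move=> s0 sN; rewrite /weighted_ehrhart.
pose A := [set u : {ffun 'I_d -> 'I_N.+1} | lattice_points R P s n (natpt R u)].
have LE : lattice_points R P s n = natpt R @` A.
  apply/seteqP; split => [x xL|_ [u Au <-]]//.
  have xE i := lattice_point_nat R d P s n x i (s0 i) xL.
  have xE' i : exists m : 'I_N.+1, x i = (m : nat)%:R.
    have [m xm mn] := xE i.
    by exists (inord m); rewrite inordK// ltnS (leq_trans mn).
  pose u := [ffun i => sval (cid (xE' i))].
  have ux : natpt R u = x.
    by apply/ffunP => i; rewrite !ffunE; case: cid.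
  by exists u; rewrite /A /= ux.
rewrite [in LHS]LE fsbig_image; last by move=> u v _ _; apply: natpt_inj.
rewrite fsbig_mkcond (_ : [set: {ffun 'I_d -> 'I_N.+1}] =
  [set` enum {ffun 'I_d -> 'I_N.+1}]); last first.
  by apply/seteqP; split => // u _ /=; rewrite mem_enum.
rewrite -fsbig_seq ?enum_uniq// big_enum [RHS]big_mkcond /=.
by apply: eq_bigr => u _; rewrite /patch; congr (if _ then _ else _).
Qed.

Lemma ehrhart_weight1 (R : realType) (d : nat) (P : rel 'I_d)
    (s : 'I_d -> nat) (n : nat) : (forall i, 0 < s i)%N ->
  weighted_ehrhart P s (fun _ => 1 : R) n = (ehrhart R P s n)%:R.
Proof.
move=> s0; rewrite /weighted_ehrhart fsbig_finite; last exact: finite_lattice_points.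
by rewrite big_const_seq iter_addr_0 count_predT.
Qed.

Lemma sum_extend (R : realType) (A : finType) (d : nat) (h : 'I_d.+1)
    (F : {ffun 'I_d.+1 -> A} -> R) (C : pred {ffun 'I_d.+1 -> A}) :
  \sum_(f | C f) F f =
  \sum_(u : {ffun 'I_d -> A}) \sum_(y | C [ffun i => extend h u y i])
     F [ffun i => extend h u y i].
Proof.
rewrite pair_big_dep /=.
apply: (reindex (fun p : {ffun 'I_d -> A} * A =>
  [ffun i => extend h p.1 p.2 i])).
apply: onW_bij; exists (fun f : {ffun 'I_d.+1 -> A} =>
  ([ffun i => f (lift h i)], f h)) => [[u y]|f].
  congr pair; last by rewrite ffunE extend_new.
  by apply/ffunP => i; rewrite !ffunE extend_old.
apply/ffunP => i; rewrite ffunE /extend.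
by case: unliftP => [j|] -> //=; rewrite ffunE.
Qed.

Lemma natpt_extend (R : realType) (d N : nat) (h : 'I_d.+1)
    (u : {ffun 'I_d -> 'I_N.+1}) (y : 'I_N.+1) :
  natpt R [ffun i => extend h u y i] =
  [ffun i => extend h (natpt R u) (y : nat)%:R i].
Proof.
apply/ffunP => i; rewrite !ffunE /extend.
by case: unliftP => [j|] _ //=; rewrite ffunE.
Qed.

(** Sum over the fibres of the map forgetting the new coordinate: over a lattice point [x] the fibre
    is 0 <= y < M, and the hockey-stick identity evaluates its sum. The factor [g] stands for the
    remaining weights. *)
Lemma weighted_ehrhart_extend (R : realType) (d : nat) (P : rel 'I_d)
    (s : 'I_d -> nat) (k : 'I_d) (t : nat) (strictly : bool) (n : nat)
    (a b : nat) (g w : {ffun 'I_d -> R} -> R)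
    (w' : {ffun 'I_d.+1 -> R} -> R) :
  let h := extreme_label strictly d in
  partial_order P -> (forall i, 0 < s i)%N -> (0 < t)%N -> (a <= b)%N ->
  (forall (x : {ffun 'I_d -> R}) (y : nat),
     w' [ffun i => extend h x y%:R i] = ('C(y + a, b))%:R * g x) ->
  (forall x, lattice_points R P s n x -> exists2 M : nat,
     w x = ('C(M + a, b.+1))%:R * g x &
     forall y : nat,
       (y%:R / t%:R < x k / (s k)%:R ?<= if ~~ strictly) = (y < M)%N) ->
  weighted_ehrhart (extend_rel h P k) (extend h s t) w' n =
  weighted_ehrhart P s w n.
Proof.
move=> h hP s0 t0 ab w'E wE.
pose N := (maxn (n * t) (\max_i (n * s i)))%N.
have tN : (n * t <= N)%N by exact: leq_maxl.
have sN i : (n * s i <= N)%N.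
  by rewrite (leq_trans _ (leq_maxr _ _))// (leq_bigmax i).
rewrite (weighted_ehrhart_natpt R _ _ s _ n N)//.
rewrite (weighted_ehrhart_natpt R _ _ (extend h s t) _ n N); first last.
- by move=> i; rewrite /extend; case: unliftP => [j|] _ /=.
- by move=> i; rewrite /extend; case: unliftP => [j|] _ /=.
rewrite (sum_extend R _ _ h) [RHS]big_mkcond; apply: eq_bigr => u _.
under eq_bigl do rewrite natpt_extend.
under eq_bigr do rewrite natpt_extend w'E.
set x := natpt R u.
have pE (y : nat) : `[< lattice_points R (extend_rel h P k) (extend h s t) n
      [ffun i => extend h x y%:R i] >] =
    `[< lattice_points R P s n x >] &&
    (y%:R / t%:R < x k / (s k)%:R ?<= if ~~ strictly).
  apply/asboolP/andP => [/lattice_points_extend[]// /asboolP //|].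
  case=> /asboolP xL yk; apply/lattice_points_extend => //; split=> //.
  by rewrite divr_ge0.
under eq_bigl do rewrite pE.
case: asboolP => [xL|_] /=; last by rewrite big_pred0.
have [M -> yM] := wE x xL.
under eq_bigl do rewrite yM.
(* The box does not truncate the fibre: its largest element M - 1 satisfies (M - 1) / t <= x k / s k
   <= n, hence M - 1 <= n * t <= N. *)
have MN : (M <= N.+1)%N.
  case: M yM => // M yM; have := yM M; rewrite ltnSn => /lteifW.
  have [[_ bd] _] := xL; have /andP[_ xkn] := bd k.
  move=> /le_trans/(_ xkn); rewrite ler_pdivrMr ?ltr0n// -natrM ler_nat ltnS.
  by move/leq_trans; apply.
rewrite -mulr_suml -natr_sum; congr (_%:R * _).
by rewrite -(hockey_stick _ _ _ ab) [RHS]big_mkord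
  (big_ord_widen _ (fun y => 'C(y + a, b)) MN).
Qed.

(** * Weights as syntactic data, and the new element each one calls for *)

Variant weight_form := Coord | Floor | Ceil.

Record weight (d : nat) :=
  Weight { form : weight_form; coord : 'I_d; shift : nat; degree : nat }.
Arguments Weight {d}.
Arguments form {d}.
Arguments coord {d}.
Arguments shift {d}.
Arguments degree {d}.

Definition weight_arg {R : realType} {d : nat} (s : 'I_d -> nat)
    (c : weight_form) (k : 'I_d) (x : {ffun 'I_d -> R}) : R :=
  match c with
  | Coord => x k
  | Floor => (Num.floor (x k / (s k)%:R))%:~R
  | Ceil => (Num.ceil (x k / (s k)%:R))%:~R
  end.

Definition weight_eval {R : realType} {d : nat} (s : 'I_d -> nat)
    (v : weight d) (x : {ffun 'I_d -> R}) : R :=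
  gbinom (weight_arg s (form v) (coord v) x + (shift v)%:R) (degree v).

Definition admissible {d : nat} (v : weight d) : bool :=
  match form v with
  | Coord => shift v <= degree v
  | Floor => 0 < shift v <= degree v
  | Ceil => shift v < degree v
  end%N.

Definition lift_weight {d : nat} (h : 'I_d.+1) (v : weight d) : weight d.+1 :=
  Weight (form v) (lift h (coord v)) (shift v) (degree v).

Lemma weight_eval_lift (R : realType) (d : nat) (s : 'I_d -> nat) (t : nat)
    (h : 'I_d.+1) (v : weight d) (x : {ffun 'I_d -> R}) (y : R) :
  weight_eval (extend h s t) (lift_weight h v)
    [ffun i => extend h x y i] = weight_eval s v x.
Proof. by rewrite /weight_eval /weight_arg /= ffunE !extend_old. Qed.

(** A weak inequality admits one more value of y at an integral bound, which is paid for by lowering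
    the shift by one. Form (i) with shift 0 cannot afford this and takes the strict inequality; a
    ceiling counts strict solutions by nature. *)
Definition needs_strict {d : nat} (v : weight d) : bool :=
  match form v with Coord => shift v == 0 | Floor => false | Ceil => true end%N.

Definition new_scale {d : nat} (s : 'I_d -> nat) (v : weight d) : nat :=
  if form v is Coord then s (coord v) else 1.

Definition new_shift {d : nat} (v : weight d) : nat :=
  if needs_strict v then shift v else (shift v).-1.

(** This keeps the new weight admissible of form (i). With a weak inequality the shift drops along
    with the degree; for [Ceil] the shift is kept, and a < b.+1 suffices. *)
Lemma new_shift_le (d : nat) (v : weight d) (b : nat) :
  admissible v -> degree v = b.+1 -> (new_shift v <= b)%N.
Proof.
by case: v => [[] k [|a] b'] //= + E; rewrite /admissible /new_shift /= E.
Qed.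

Lemma weight_eval_count (R : realType) (d : nat) (P : rel 'I_d)
    (s : 'I_d -> nat) (v : weight d) (n : nat) (x : {ffun 'I_d -> R}) :
  (forall i, 0 < s i)%N -> admissible v -> lattice_points R P s n x ->
  let k := coord v in
  exists2 M : nat, weight_eval s v x = ('C(M + new_shift v, degree v))%:R &
    forall y : nat,
      (y%:R / (new_scale s v)%:R < x k / (s k)%:R ?<= if ~~ needs_strict v)
      = (y < M)%N.
Proof.
move=> s0; case: v => c k a b adm xL /=.
have sk0 : 0 < (s k)%:R :> R by rewrite ltr0n.
have q0 : 0 <= x k / (s k)%:R by have [[_ bd] _] := xL; have /andP[] := bd k.
case: c adm => /= adm; rewrite /weight_eval /new_shift /needs_strict /new_scale /=.
- have [m xm _] := lattice_point_nat R d P s n x k (s0 k) xL.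
  (* There are m solutions of y < m, and m + 1 of y <= m, the case of nonzero shift. *)
  exists (m + (a != 0))%N.
    rewrite xm -natrD gbinom_nat; congr ('C(_, _))%:R.
    by case: a {adm} => [|a] //=; rewrite ?addn0// addn1 addSnnS.
  move=> y; rewrite xm; case: eqP => _ /=.
    by rewrite addn0 ltr_pM2r ?invr_gt0// ltr_nat.
  by rewrite addn1 ltnS ler_pM2r ?invr_gt0// ler_nat.
- have : 0 <= Num.floor (x k / (s k)%:R) by rewrite floor_ge0.
  (* An integer y satisfies y <= q exactly when y <= floor q, so y = m counts too. *)
  case E : (Num.floor _) => [m|//] _; exists m.+1.
    rewrite -natrD gbinom_nat; congr ('C(_, _))%:R.
    by case: a adm => // a _; rewrite addSnnS.
  by move=> y; rewrite divr1 /= -[y%:R]/(y%:Z%:~R) -floor_ge_int E.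
- have : 0 <= Num.ceil (x k / (s k)%:R) by rewrite ceil_ge0 (lt_le_trans _ q0)// ltrN10.
  (* An integer y satisfies y < q exactly when y < ceil q. *)
  case E : (Num.ceil _) => [m|//] _; exists m.
    by rewrite -natrD gbinom_nat.
  by move=> y; rewrite divr1 /= -[y%:R]/(y%:Z%:~R) -ceil_gt_int E.
Qed.

(** Induction on a measure in which each weight counts its degree plus one, so that both lowering a
    degree and discarding a weight of degree 0 decrease it. *)
Lemma weighted_ehrhart_prod (R : realType) (m d : nat) (P : rel 'I_d)
    (s : 'I_d -> nat) (vs : seq (weight d)) :
  (\sum_(v <- vs) (degree v).+1 <= m)%N ->
  partial_order P -> (forall i, 0 < s i)%N -> all admissible vs ->
  exists (d' : nat) (P' : rel 'I_d') (s' : 'I_d' -> nat),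
    [/\ partial_order P', (forall i, 0 < s' i)%N &
        forall n, weighted_ehrhart P s
          (fun x : {ffun 'I_d -> R} => \prod_(v <- vs) weight_eval s v x) n =
          (ehrhart R P' s' n)%:R].
Proof.
elim: m d P s vs => [|m IHm] d P s [|v vs] /=.
1,3: move=> _ hP s0 _; exists d, P, s; split=> // n;
  by rewrite -ehrhart_weight1//; congr weighted_ehrhart; apply/funext => x;
     rewrite big_nil.
  by rewrite big_cons addSn.
rewrite big_cons addSn ltnS => le_m hP s0 /andP[adm admvs].
case b0 : (degree v) => [|b].
  have [|d' [P' [s' [hP' s0' E]]]] := IHm d P s vs _ hP s0 admvs.
    exact: leq_trans (leq_addl _ _) le_m.
  exists d', P', s'; split=> // n; rewrite -E; congr weighted_ehrhart.
  apply/funext => x; rewrite big_cons /weight_eval b0 /gbinom big_ord0.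
  by rewrite divr1 mul1r.
pose st := needs_strict v; pose h := extreme_label st d.
(* Whatever the form of [v], its replacement is of form (i) at the new element. *)
pose v' := Weight Coord h (new_shift v) b.
pose t := new_scale s v.
have t0 : (0 < t)%N by rewrite /t /new_scale; case: form.
have ab := new_shift_le d v b adm b0.
have [||||d' [P' [s' [hP' s0' E]]]] :=
  IHm d.+1 (extend_rel h P (coord v)) (extend h s t)
    (v' :: map (lift_weight h) vs).
- by rewrite big_cons big_map /= (leq_trans _ le_m)// b0 addSn.
- exact: extend_rel_order.
- by move=> i; rewrite /extend; case: unliftP => [j|] _ /=.
- by rewrite /= {1}/admissible /= ab all_map.
exists d', P', s'; split=> // n; rewrite -E; apply/esym.
apply: (weighted_ehrhart_extend R d P s (coord v) t st n (new_shift v) b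
  (fun x => \prod_(v <- vs) weight_eval s v x)) => //.
- move=> x y; rewrite big_cons big_map; congr (_ * _).
    by rewrite /weight_eval /weight_arg /= ffunE extend_new -natrD gbinom_nat.
  by apply: eq_bigr => i _; rewrite weight_eval_lift.
- move=> x xL.
  have [M wE yM] := weight_eval_count R d P s v n x s0 adm xL.
  by exists M => //; rewrite big_cons wE b0.
Qed.

Theorem proposition1p1 (R : realType) (d : nat) (P : rel 'I_d)
    (s : 'I_d -> nat) (l : nat) (wi : 'I_l -> {ffun 'I_d -> R} -> R)
    (w : {ffun 'I_d -> R} -> R)
    (hd : (1 <= d)%N)
    (hP : partial_order P)
    (hs : forall i : 'I_d, (0 < s i)%N)
    (hwi : forall i : 'I_l,
       [\/ weight_coord (wi i), weight_floor s (wi i) | weight_ceil s (wi i)])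
    (hw : forall x : {ffun 'I_d -> R}, w x = \prod_(i < l) wi i x) :
  exists (d' : nat) (P' : rel 'I_d') (s' : 'I_d' -> nat),
    [/\ partial_order P',
        (forall i : 'I_d', (0 < s' i)%N) &
        forall n : nat, weighted_ehrhart P s w n = (ehrhart R P' s' n)%:R].
Proof.
(* Choice turns the existential descriptions of the [wi] into a list of syntactic weights. *)
have /choice[V VP] i : exists v : weight d,
    admissible v /\ wi i =1 weight_eval s v.
  by case: (hwi i) => -[k [a [b [ab wE]]]];
    [exists (Weight Coord k a b) | exists (Weight Floor k a b)
    | exists (Weight Ceil k a b)].
have [|d' [P' [s' [hP' s0' E]]]] :=
  weighted_ehrhart_prod R _ d P s (map V (enum 'I_l)) (leqnn _) hP hs.
  by rewrite all_map; apply/allP => i _ /=; case: (VP i).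
exists d', P', s'; split=> // n; rewrite -E; congr weighted_ehrhart.
apply/funext => x; rewrite hw big_map big_enum.
by apply: eq_bigr => i _; case: (VP i) => _ ->.
Qed.
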